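(* For every $n\ge 3$, the $2$-optimal rubbling number of the cycle $C_n$ is $n$; that is, the minimum size of a pebble distribution on $C_n$ from which every vertex is $2$-reachable is $n$.
   Context: $C_n$ is the cycle on $n$ vertices. A pebble distribution is a function $p:V\to\mathbb{Z}_{\ge0}$; its size is the total number of pebbles. A pebbling move along an edge $\{v,u\}$ removes two pebbles from $v$ and adds one at $u$; a strict rubbling move $(v,w\to u)$ with $v\neq w$ both adjacent to $u$ removes one pebble from each of $v,w$ and adds one at $u$; rubbling moves are either kind. A sequence of rubbling moves is executable if pebble counts stay nonnegative throughout. A vertex $v$ is $k$-reachable if some executable sequence ends with at least $k$ pebbles on $v$; a distribution is $k$-solvable if every vertex is $k$-reachable. The $2$-optimal rubbling number is the minimum size of a $2$-solvable distribution. *)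

(* Defs.v *)
(* MathComp. A graph is given by its adjacency relation on a finite type of
   vertices. *)
From mathcomp Require Import all_boot.

Set Implicit Arguments.
Unset Strict Implicit.
Unset Printing Implicit Defensive.

(* The cycle C_n on Z/n (simple only when 2 < n): ordS is the successor
   modulo n. *)
Definition cycle_adj (n : nat) : rel 'I_n :=
  fun i j => (j == ordS i) || (i == ordS j).

Section Rubbling.

Variables (T : finType) (adj : rel T).

Definition distribution := {ffun T -> nat}.

Definition dist_size (p : distribution) : nat := \sum_(x : T) p x.

(* [Pebbling v u] moves along the edge {v, u}, from v to u;
   [StrictRubbling v w u] is the move (v, w -> u). *)
Inductive move : Type :=
  | Pebbling of T & T
  | StrictRubbling of T & T & T.

Definition legal_move (m : move) : bool :=
  match m with
  | Pebbling v u => adj v u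
  | StrictRubbling v w u => [&& v != w, adj v u & adj w u]
  end.

Definition removed (m : move) (x : T) : nat :=
  match m with
  | Pebbling v _ => if x == v then 2 else 0
  | StrictRubbling v w _ => if (x == v) || (x == w) then 1 else 0
  end.

Definition added (m : move) (x : T) : nat :=
  match m with
  | Pebbling _ u | StrictRubbling _ _ u => if x == u then 1 else 0
  end.

(* The subtraction is truncated; [executable] requires [removed m x <= p x]
   at every step, so that no truncation occurs. *)
Definition do_move (p : distribution) (m : move) : distribution :=
  [ffun x => p x - removed m x + added m x].

Definition run (p : distribution) (s : seq move) : distribution :=
  foldl do_move p s.

Fixpoint executable (p : distribution) (s : seq move) : bool :=
  match s with
  | [::] => true
  | m :: s' => [&& legal_move m, [forall x, removed m x <= p x]
                 & executable (do_move p m) s']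
  end.

Definition reachable (k : nat) (p : distribution) (v : T) : Prop :=
  exists2 s : seq move, executable p s & k <= run p s v.

Definition solvable (k : nat) (p : distribution) : Prop :=
  forall v : T, reachable k p v.

(* m is the k-optimal rubbling number: the minimum, attained, of the sizes of
   the k-solvable distributions. *)
Definition is_optimal_rubbling_number (k m : nat) : Prop :=
  (exists2 p : distribution, solvable k p & dist_size p = m) /\
  (forall p : distribution, solvable k p -> m <= dist_size p).

End Rubbling.

(* Main.v *)
Require Import Defs.
From mathcomp Require Import all_boot.
From mathcomp Require Import zify.

Set Implicit Arguments.
Unset Strict Implicit.
Unset Printing Implicit Defensive.

(** A pebble that is worth moving travels towards its target, and half of the
    pebbles are lost at every step.  So, writing [f] and [g] for the successor
    and the predecessor on the cycle, let [R] and [L] solve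
    [R x = p x + floor (R (f x) / 2)] and [L x = p x + floor (L (g x) / 2)];
    at most [p x + floor ((R (f x) + L (g x)) / 2)] pebbles can be gathered
    on [x].  Summing the equations, the size of [p] is
    [sum_x ceil (R x / 2) = sum_x ceil (L x / 2)].  If [p] is 2-solvable, then
    [L x = 0] forces [R (f x) >= 3], and [R x = 0] forces [L (g x) >= 3]: each
    zero of one of the functions is compensated by a surplus of the other, so
    that twice the size of [p] is at least [2n]. *)

Section Flow.

Variables (T : finType) (f : T -> T).
Implicit Types (p : distribution T) (R : T -> nat).

Definition flow_bound R p := forall x, p x + (R (f x))./2 <= R x.

Definition flow R p := forall x, R x = p x + (R (f x))./2.

Lemma flow_is_bound R p : flow R p -> flow_bound R p.
Proof. by move=> flowR x; rewrite [leqRHS]flowR. Qed.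

(** The equations may be circular, so their right-hand side is iterated from an upper bound: the sum
    of [R] drops strictly until a fixed point is reached. *)
Lemma flow_exists p : exists R, flow R p.
Proof.
pose step R x := p x + (R (f x))./2.
suff descend k R : \sum_x R x <= k -> flow_bound R p -> exists R', flow R' p.
  (* Since [p x <= dist_size p], this constant is a flow bound. *)
  apply: (descend _ (fun=> (dist_size p).*2)) (leqnn _) _ => x.
  rewrite doubleK -addnn leq_add2r /dist_size (bigD1 x) //=; exact: leq_addr.
elim: k R => [|k IHk] R leRk boundR.
  exists R => x; apply/eqP; rewrite eqn_leq boundR andbT.
  by move: leRk; rewrite (bigD1 x) //=; lia.
have [/forallP fixR|] := boolP [forall x, R x == step R x].
  by exists R => x; apply/eqP/fixR.
rewrite negb_forall => /existsP[x neqx].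
apply: (IHk (step R)) => [|y]; last first.
  by rewrite leq_add2l half_leq ?boundR.
rewrite -ltnS; apply: leq_trans leRk.
rewrite (bigD1 x) //= [ltnRHS](bigD1 x) //=.
rewrite -addSn leq_add ?leq_sum // => [|y _]; last exact: boundR.
by rewrite ltn_neqAle eq_sym neqx boundR.
Qed.

Lemma dist_size_flow R p :
  injective f -> flow R p -> dist_size p = \sum_x uphalf (R x).
Proof.
move=> injf flowR; apply/eqP.
rewrite -(eqn_add2r (\sum_x (R (f x))./2)) -big_split /=.
rewrite -(eq_bigr _ (fun x _ => flowR x)).
rewrite -(reindex_inj (P := xpredT) (F := fun x => (R x)./2) injf) -big_split.
by apply/eqP/eq_bigr => x _ /=; lia.
Qed.

(* [R] need not stay a flow for the distribution after the move [m], but only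
   an upper bound in the sense of [flow_bound].  A pebble moved along the flow
   was already counted at its destination, hence the asymmetry between the
   two directions. *)
Definition shift_flow (m : move T) R x :=
  match m with
  | Pebbling w u =>
      if w == f u then R x - (if x == w then 2 else 0)
      else R x - (x == w) + (x == u)
  | StrictRubbling _ _ u => R x - (x == f u) + (x == u)
  end.

End Flow.

(** The two flows are added before halving because a strict rubbling move can pair a pebble from
    each side. *)
Definition reach_bound (T : finType) (f g : T -> T) (R L : T -> nat)
  (p : distribution T) (x : T) := p x + (R (f x) + L (g x))./2.

(** Symmetric in [f] and [g], so that each fact is proved for one direction only; [f (f x) != x]
    keeps the two neighbours of a vertex distinct. *)
Definition opposite_steps (T : eqType) (adj : rel T) (f g : T -> T) :=
  [/\ cancel f g, cancel g f, forall x, f x != x, forall x, f (f x) != x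
    & forall x y, adj x y = (y == f x) || (x == f y)].

Lemma opposite_stepsC (T : eqType) (adj : rel T) (f g : T -> T) :
  opposite_steps adj f g -> opposite_steps adj g f.
Proof.
case=> fK gK f_neq ff_neq adjE; split=> // [x|x|x y].
- by rewrite (can2_eq gK fK) eq_sym.
- by rewrite !(can2_eq gK fK) eq_sym.
- by rewrite adjE orbC ![_ == f _]eq_sym !(can2_eq fK gK).
Qed.

Section Cycle.

Variables (T : finType) (adj : rel T) (f g : T -> T).
Hypothesis steps : opposite_steps adj f g.
Implicit Types (p : distribution T) (R L : T -> nat) (m : move T).

Let fK : cancel f g. Proof. by case: steps. Qed.

Let gK : cancel g f. Proof. by case: steps. Qed.

Let fgE x y : (f x == y) = (x == g y). Proof. exact: can2_eq. Qed.

Let gfE x y : (g x == y) = (x == f y). Proof. exact: can2_eq. Qed.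

Let neqE : (forall u, (f u == u) = false) * (forall u, (u == f u) = false)
  * (forall u, (g u == u) = false) * (forall u, (u == g u) = false)
  * (forall u, (g u == f u) = false) * (forall u, (f u == g u) = false).
Proof.
have [_ _ f_neq ff_neq _] := steps.
have fN u : (f u == u) = false by apply/negbTE/f_neq.
have ffN u : (g u == f u) = false by rewrite gfE eq_sym; apply/negbTE/ff_neq.
have gN u : (g u == u) = false by rewrite gfE eq_sym.
by (do 5?split) => u; rewrite ?fN ?gN ?ffN // eq_sym ?fN ?gN ?ffN.
Qed.

Lemma legal_moveP m : legal_move adj m ->
  match m with
  | Pebbling v u => v = g u \/ v = f u
  | StrictRubbling v w u => (v = g u /\ w = f u) \/ (v = f u /\ w = g u)
  end.
Proof.
have [_ _ _ _ adjE] := steps.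
case: m => [v u|v w u] /=; rewrite !adjE ![u == f _]eq_sym !fgE.
  by case/orP=> /eqP; auto.
case/and3P=> neq /orP[]/eqP ev /orP[]/eqP ew; subst; auto.
all: by rewrite eqxx in neq.
Qed.

(** If [R] grows by one at the target [u], the half passed on to [g u] grows by at most one, which
    the pebbles removed from [g u] pay for. *)
Lemma shift_flow_bound R p m : flow_bound f R p -> legal_move adj m ->
  (forall x, removed m x <= p x) ->
  flow_bound f (shift_flow f m R) (do_move p m).
Proof.
move=> boundR /legal_moveP legal rem x.
have := boundR x; have := boundR (f x); have := rem x; have := rem (f x).
rewrite ffunE.
case: m legal {rem} => [v u [->|->]|v w u [[-> ->]|[-> ->]]] /=.
all: rewrite ?eqxx ?neqE ?fgE ?fK.
all: have [->|_] := eqVneq x u; rewrite ?eqxx ?neqE ?gK ?fK /=; try lia.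
all: have [->|_] := eqVneq x (f u); rewrite ?eqxx ?neqE ?gK ?fK /=; try lia.
all: by case: (x == g u) => /=; lia.
Qed.

(** At the target [u], the new pebble is offset by a loss of two in [R (f u) + L (g u)]. At a
    source, the halved sum gains at most one while a pebble or two are lost. *)
Lemma reach_bound_move R L p m x : flow_bound f R p -> flow_bound g L p ->
  legal_move adj m -> (forall y, removed m y <= p y) ->
  reach_bound f g (shift_flow f m R) (shift_flow g m L) (do_move p m) x
    <= reach_bound f g R L p x.
Proof.
move=> boundR boundL /legal_moveP legal rem; rewrite /reach_bound.
have := boundR (f x); have := boundL (g x).
have := rem x; have := rem (f x); have := rem (g x).
rewrite ffunE.
case: m legal {rem} => [v u [->|->]|v w u [[-> ->]|[-> ->]]] /=.
all: rewrite ?eqxx ?neqE ?fgE ?gfE ?fK ?gK.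
all: have [->|_] := eqVneq x u; rewrite ?eqxx ?neqE ?gK ?fK ?orbT /=; try lia.
all: have [->|_] := eqVneq x (f u); rewrite ?eqxx ?neqE ?gK ?fK /=; try lia.
all: by case: (x == g u) => /=; lia.
Qed.

End Cycle.

Section Reachability.

Variables (T : finType) (adj : rel T) (f g : T -> T).
Hypothesis steps : opposite_steps adj f g.
Implicit Types (p : distribution T) (R L : T -> nat).

Lemma run_le_reach_bound R L p s x :
  flow_bound f R p -> flow_bound g L p -> executable adj p s ->
  run p s x <= reach_bound f g R L p x.
Proof.
elim: s p R L => [|m s IHs] p R L boundR boundL /=; first by rewrite leq_addr.
case/and3P=> legal /forallP rem exec.
apply: leq_trans (reach_bound_move steps x boundR boundL legal rem).
apply: IHs => //; first exact: shift_flow_bound steps _ _ _ boundR legal rem.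
exact: shift_flow_bound (opposite_stepsC steps) _ _ _ boundL legal rem.
Qed.

Lemma flow_zero_surplus R L p :
  flow f R p -> flow g L p -> solvable adj 2 p ->
  #|T| + #|[pred x | L x == 0]| <= dist_size p + #|[pred x | R x == 0]|.
Proof.
move=> flowR flowL solp.
have injf : injective f by case: steps => /can_inj.
have cardE (A : pred T) : #|[pred x | A x]| = \sum_x (A x : nat).
  by rewrite -sum1_card big_mkcond.
rewrite (dist_size_flow injf flowR) !cardE -!big_split /=.
(* Termwise, [uphalf (R (f x)) + (R (f x) == 0)] is at least 1, and at least 2 when [L x = 0], as
   then [R (f x) >= 3]. *)
rewrite [leqRHS](reindex_inj injf) /= leq_sum // => x _.
have [s exec reach] := solp x.
have := leq_trans reach (run_le_reach_bound x (flow_is_bound flowR)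
  (flow_is_bound flowL) exec).
rewrite /reach_bound; have := flowL x.
by case: (L x) (R (f x)) => [|k] [|[|[|r]]] /=; lia.
Qed.

End Reachability.

Section CycleGraph.

Variable n : nat.
Hypothesis n_gt2 : 2 < n.

Lemma ordS_neq (i : 'I_n) : ordS i != i.
Proof.
rewrite -val_eqE /=; have := ltn_ord i; rewrite leq_eqVlt.
by case/orP=> [/eqP eni|lt_in]; rewrite ?eni ?modnn ?(modn_small lt_in); lia.
Qed.

Lemma ordSS_neq (i : 'I_n) : ordS (ordS i) != i.
Proof.
rewrite -val_eqE /=; have := ltn_ord i; rewrite leq_eqVlt.
case/orP=> [/eqP eni|lt_in]; first by rewrite ?eni modnn modn_small; lia.
rewrite (modn_small lt_in); move: lt_in; rewrite leq_eqVlt.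
by case/orP=> [/eqP eni|lt_in]; rewrite ?eni ?modnn ?(modn_small lt_in); lia.
Qed.

Lemma cycle_steps : opposite_steps (@cycle_adj n) (@ordS n) (@ord_pred n).
Proof.
by split; [apply: ordSK|apply: ord_predK|apply: ordS_neq|apply: ordSS_neq|].
Qed.

(** The two neighbours of [i] jointly send it one pebble, which joins its own. *)
Lemma cycle_ones_solvable :
  solvable (@cycle_adj n) 2 ([ffun=> 1] : distribution 'I_n).
Proof.
move=> i; have SK := @ordSK n; have PK := @ord_predK n.
exists [:: StrictRubbling (ord_pred i) (ordS i) i] => /=.
  rewrite (can2_eq PK SK) eq_sym ordSS_neq /cycle_adj PK !eqxx orbT /= andbT.
  by apply/forallP=> x; rewrite ffunE; case: ifP.
rewrite /= !ffunE /= eqxx.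
by rewrite -(can2_eq SK PK) [i == _]eq_sym (negPf (ordS_neq i)).
Qed.

Lemma cycle_solvable_size (p : distribution 'I_n) :
  solvable (@cycle_adj n) 2 p -> n <= dist_size p.
Proof.
move=> solp.
have [R flowR] := flow_exists (@ordS n) p.
have [L flowL] := flow_exists (@ord_pred n) p.
(* Adding the inequalities for both directions cancels the counts of zeros. *)
have := flow_zero_surplus cycle_steps flowR flowL solp.
have := flow_zero_surplus (opposite_stepsC cycle_steps) flowL flowR solp.
by rewrite card_ord; move: #|_| #|_| (dist_size p) => r l d; lia.
Qed.

End CycleGraph.

Theorem theorem2 (n : nat) (hn : 3 <= n) :
  is_optimal_rubbling_number (@cycle_adj n) 2 n.
Proof.
split; last exact: cycle_solvable_size.
exists [ffun=> 1]; first exact: cycle_ones_solvable.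
rewrite /dist_size (eq_bigr (fun=> 1)) => [|x _]; last by rewrite ffunE.
by rewrite sum1_card card_ord.
Qed.
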